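(* Let $r\ge1$ be an integer and $x_1,\dots,x_r,y$ indeterminates. Then for every $n\ge0$, $$L_n(\boldsymbol{e}(x_1,\dots,x_r),y)=S^{(r)}_n(\boldsymbol{\alpha}),$$ where $\boldsymbol{\alpha}=(\alpha_i)_{i\ge r}=(y,x_1,\dots,x_r,\,y,2x_1,\dots,2x_r,\,y,3x_1,\dots,3x_r,\dots)$; explicitly, for $i\ge r$, $\alpha_i=y$ if $i\equiv r \pmod{r+1}$, and $\alpha_i=\lfloor i/(r+1)\rfloor\, x_{j+1}$ if $i\equiv j\pmod{r+1}$ with $0\le j\le r-1$.
   Context: $\boldsymbol{e}(x_1,\dots,x_r)=(e_n(x_1,\dots,x_r))_{n\ge0}$ are the elementary symmetric polynomials ($e_0=1$, $e_n=0$ for $n>r$). Generic Lah polynomials: an ordered tree is a rooted tree in which the children of each vertex are linearly ordered; an increasing ordered tree on a finite set of integers is an ordered tree bijectively labeled by that set so that every child has larger label than its parent. For $\boldsymbol{\phi}=(\phi_i)_{i\ge0}$, $L_{n,k}(\boldsymbol{\phi})$ is the sum over unordered forests of $k$ increasing ordered trees whose vertex sets partition $[n]$ of $\prod_v\phi_{\deg(v)}$ ($\deg(v)$ = number of children; $L_{0,0}=1$), and $L_n(\boldsymbol{\phi},y)=\sum_{k=0}^nL_{n,k}(\boldsymbol{\phi})y^k$. $m$-Stieltjes–Rogers polynomials: for an integer $m\ge1$, an $m$-Dyck path of length $(m+1)n$ is a path in $\mathbb{Z}\times\mathbb{N}$ from $(0,0)$ to $((m+1)n,0)$ using steps $(1,1)$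 (rises) and $(1,-m)$ ($m$-falls). Given $\boldsymbol{\alpha}=(\alpha_i)_{i\ge m}$, $S^{(m)}_n(\boldsymbol{\alpha})$ is the sum over all such paths of the product of weights, where each rise has weight $1$ and each $m$-fall starting at height $i$ has weight $\alpha_i$. *)

(* Defs.v *)
From mathcomp Require Import all_boot all_order all_algebra.
From mathcomp Require Export mpoly.

Set Implicit Arguments.
Unset Strict Implicit.
Unset Printing Implicit Defensive.

Import GRing.Theory.
Local Open Scope ring_scope.

(* The label set [n] = {1, ..., n} is represented, order-isomorphically, by
   'I_n. An ordered forest on it is given by the function sending each vertex
   to the linearly ordered list of its children; as these lists are
   duplicate-free (see below), the length bound n of {bseq n of 'I_n} only
   serves to make the type finite. *)
Definition children_map (n : nat) := {ffun 'I_n -> {bseq n of 'I_n}}.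

Definition all_children (n : nat) (c : children_map n) : seq 'I_n :=
  flatten [seq (c v : seq 'I_n) | v <- enum 'I_n].

(* No vertex occurs twice as a child (neither of two vertices nor twice in one
   list), and every child has a larger label than its parent. The second
   condition excludes cycles, so such a c is exactly an unordered forest of
   increasing ordered trees whose vertex sets partition 'I_n. *)
Definition increasing_ordered_forest (n : nat) (c : children_map n) : bool :=
  uniq (all_children c) &&
  [forall v : 'I_n, forall w : 'I_n, (w \in (c v : seq 'I_n)) ==> (v < w)%N].

(* There is one root for each tree of the forest. *)
Definition roots (n : nat) (c : children_map n) : {set 'I_n} :=
  [set v | v \notin all_children c].

Definition nb_children (n : nat) (c : children_map n) (v : 'I_n) : nat :=
  size (c v).

Definition Lah (R : comNzRingType) (phi : nat -> R) (n k : nat) : R :=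
  \sum_(c : children_map n | increasing_ordered_forest c && (#|roots c| == k))
    \prod_(v < n) phi (nb_children c v).

(* The indeterminate y is the 'X of {poly R}. *)
Definition Lah_poly (R : comNzRingType) (phi : nat -> R) (n : nat) : {poly R} :=
  \sum_(k < n.+1) Lah phi n k *: 'X^k.

(* A path is given by its word of steps: true is a rise (1, 1), false is an
   m-fall (1, -m). [mpath m h s] says that s, started at height h, never goes
   below height 0 and ends at height 0. *)
Fixpoint mpath (m h : nat) (s : seq bool) : bool :=
  match s with
  | [::] => h == 0%N
  | true :: s' => mpath m h.+1 s'
  | false :: s' => (m <= h)%N && mpath m (h - m) s'
  end.

Fixpoint mpath_weight (R : comNzRingType) (m : nat) (alpha : nat -> R)
    (h : nat) (s : seq bool) : R :=
  match s with
  | [::] => 1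
  | true :: s' => mpath_weight m alpha h.+1 s'
  | false :: s' => alpha h * mpath_weight m alpha (h - m) s'
  end.

(* The values alpha i with i < m play no role, as every m-fall of an m-Dyck
   path starts at height at least m. *)
Definition Stieltjes_Rogers (R : comNzRingType) (m : nat) (alpha : nat -> R)
    (n : nat) : R :=
  \sum_(s : (m.+1 * n).-tuple bool | mpath m 0 s) mpath_weight m alpha 0 s.

(* With j = i %% r.+1, insub yields Some j (as an element of 'I_r) when j < r,
   and None when j = r. The variables x_1, ..., x_r are indexed from 0, so
   x_(j+1) is x j. *)
Definition Lah_alpha (R : comNzRingType) (r : nat) (x : 'I_r -> R) (y : R)
    (i : nat) : R :=
  match insub (i %% r.+1)%N : option 'I_r with
  | Some j => (i %/ r.+1)%:R * x j
  | None => y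
  end.

(* Main.v *)
Require Import Defs.
From mathcomp Require Import all_boot all_order all_algebra.

(** Write D for d/dy. Adding a smallest vertex to a forest gives
    L_(n+1) = y * (sum_i phi_i D^i) L_n, so for phi = e(x_1, ..., x_r) the
    polynomial L_n is (y (1 + x_1 D) ... (1 + x_r D))^n applied to 1. On the
    path side, a height (r+1) k + j is encoded by the monomial z^k; the steps
    starting at residue j < r act as 1 + x_(j+1) d/dz and those starting at
    residue r act as multiplication by z + y. Hence S_n is
    ((z + y) (1 + x_1 d/dz) ... (1 + x_r d/dz))^n applied to 1, at z = 0, which
    is L_n(z + y) at z = 0. *)

Set Implicit Arguments.
Unset Strict Implicit.
Unset Printing Implicit Defensive.

Import GRing.Theory.
Local Open Scope ring_scope.

(** * Differential operators with constant coefficients *)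

(** This is [q](D) applied to [p]: the indeterminate of [q] stands for D. *)
Definition diffop (R : comNzRingType) (q p : {poly R}) : {poly R} :=
  \sum_(i < size q) q`_i *: p^`(i).

Lemma diffop_widen (R : comNzRingType) (q p : {poly R}) N :
  (size q <= N)%N -> diffop q p = \sum_(i < N) q`_i *: p^`(i).
Proof.
move=> leqN; rewrite /diffop (big_ord_widen N (fun i => q`_i *: p^`(i)) leqN).
rewrite big_mkcond; apply: eq_bigr => i _; case: ltnP => // le_q_i.
by rewrite nth_default ?scale0r.
Qed.

(** Derivatives of order at least [size p] vanish, so [N] may be smaller than [size q]. *)
Lemma diffop_trunc (R : comNzRingType) (q p : {poly R}) N :
  (size p <= N)%N -> diffop q p = \sum_(i < N) q`_i *: p^`(i).
Proof.
move=> lepN; rewrite (diffop_widen p (leq_maxl (size q) N)).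
rewrite (big_ord_widen _ (fun i => q`_i *: p^`(i)) (leq_maxr (size q) N)).
rewrite [RHS]big_mkcond; apply: eq_bigr => i _; case: ltnP => // le_N_i.
by rewrite derivn_poly0 ?scaler0 // (leq_trans lepN).
Qed.

Lemma diffop1 (R : comNzRingType) (p : {poly R}) : diffop 1 p = p.
Proof. by rewrite /diffop size_poly1 big_ord1 coef1 scale1r. Qed.

(** Products of symbols act as compositions of operators; one linear factor at a time is enough for
    e(x_1, ..., x_r). *)
Lemma diffop_mul1DX (R : comNzRingType) (a : R) (q p : {poly R}) :
  diffop ((1 + a *: 'X) * q) p = diffop q p + a *: (diffop q p)^`().
Proof.
have sz1 : (size (1 + a *: 'X : {poly R})%R <= 2)%N.
  rewrite (leq_trans (size_polyD _ _)) // geq_max size_poly1 /=.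
  by rewrite (leq_trans (size_scale_leq _ _)) // size_polyX.
have szm : (size ((1 + a *: 'X) * q)%R <= (size q).+1)%N.
  rewrite (leq_trans (size_polyMleq _ _)) //.
  by rewrite -subn1 leq_subLR -[(1 + _)%N]/((2 + size q)%N) leq_add2r.
rewrite (diffop_widen p szm) {1}(diffop_widen p (leqnSn (size q))).
under eq_bigr do rewrite mulrDl mul1r coefD -scalerAl coefZ coefXM scalerDl.
rewrite big_split /=; congr (_ + _).
rewrite big_ord_recl /= mulr0 scale0r add0r /diffop raddf_sum /= scaler_sumr.
by apply: eq_bigr => i _; rewrite -scalerA derivZ -derivnS.
Qed.

Lemma derivn_comp_XaddC (R : comNzRingType) (p : {poly R}) (c : R) k :
  (p \Po ('X + c%:P))^`(k) = p^`(k) \Po ('X + c%:P).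
Proof.
elim: k => // k IHk; rewrite !derivnS IHk deriv_comp.
by rewrite derivD derivX derivC addr0 mulr1.
Qed.

(** D commutes with translations, so the substitution of z + y for y passes through the
    iteration. *)
Lemma diffop_comp_XaddC (R : comNzRingType) (q p : {poly R}) (c : R) :
  diffop q (p \Po ('X + c%:P)) = diffop q p \Po ('X + c%:P).
Proof.
rewrite /diffop raddf_sum /=; apply: eq_bigr => i _.
by rewrite derivn_comp_XaddC comp_polyZ.
Qed.

Lemma diffop_map (R S : comNzRingType) (f : {rmorphism R -> S})
    (q p : {poly R}) :
  diffop (map_poly f q) (map_poly f p) = map_poly f (diffop q p).
Proof.
rewrite (diffop_widen _ (size_poly _ _)) /diffop raddf_sum /=.
by apply: eq_bigr => i _; rewrite coef_map derivn_map map_polyZ.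
Qed.

(** * Path sums as products of operators indexed by residues of heights *)

Definition path_sum (R : comNzRingType) (m : nat) (alpha : nat -> R)
    (N h : nat) : R :=
  \sum_(s : N.-tuple bool | mpath m h s) mpath_weight m alpha h s.

Lemma path_sum0 (R : comNzRingType) m (alpha : nat -> R) h :
  path_sum m alpha 0 h = (h == 0%N)%:R.
Proof.
rewrite /path_sum big_mkcond (big_pred1 [tuple]) => [|s]; last first.
  by rewrite [s]tuple0 /= eqxx.
by rewrite /=; case: (h == 0%N).
Qed.

Lemma path_sumS (R : comNzRingType) m (alpha : nat -> R) N h :
  path_sum m alpha N.+1 h = path_sum m alpha N h.+1 +
    (if (m <= h)%N then alpha h * path_sum m alpha N (h - m) else 0).
Proof.
rewrite /path_sum.
rewrite (reindex (fun p : bool * N.-tuple bool => [tuple of p.1 :: p.2])) /=; last first.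
  exists (fun t => (thead t, [tuple of behead t])) => [[b s] _|t _] /=.
    by congr (_, _); apply/val_inj.
  by rewrite -tuple_eta.
rewrite -(pair_big_dep xpredT
  (fun b (s : N.-tuple bool) => mpath m h (b :: s))
  (fun b (s : N.-tuple bool) => mpath_weight m alpha h (b :: s))) /=.
rewrite big_bool /=; congr (_ + _).
by case: (m <= h)%N; rewrite ?big_pred0_eq // big_distrr.
Qed.

(** Here [t] is a height, relevant only modulo [r.+1], and the indeterminate of [p] is z. *)
Definition residue_op (R : comNzRingType) r (x : 'I_r -> R) (y : R)
    (t : nat) (p : {poly R}) : {poly R} :=
  match insub (t %% r.+1)%N : option 'I_r with
  | Some j => p + x j *: p^`()
  | None => ('X + y%:P) * p
  end.

Fixpoint residue_run (R : comNzRingType) r (x : 'I_r -> R) (y : R)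
    (N t : nat) (p : {poly R}) : {poly R} :=
  if N is N'.+1 then residue_run x y N' t.+1 (residue_op x y t p) else p.

Lemma residue_opD (R : comNzRingType) r (x : 'I_r -> R) y t p q :
  residue_op x y t (p + q) = residue_op x y t p + residue_op x y t q.
Proof.
rewrite /residue_op; case: insub => [j|]; last by rewrite mulrDr.
by rewrite derivD scalerDr addrACA.
Qed.

Lemma residue_opZ (R : comNzRingType) r (x : 'I_r -> R) y t (a : R) p :
  residue_op x y t (a *: p) = a *: residue_op x y t p.
Proof.
rewrite /residue_op; case: insub => [j|]; last by rewrite scalerAr.
by rewrite derivZ scalerDr !scalerA mulrC.
Qed.

Lemma residue_runD (R : comNzRingType) r (x : 'I_r -> R) y N t p q :
  residue_run x y N t (p + q) = residue_run x y N t p + residue_run x y N t q.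
Proof. by elim: N t p q => //= N IHN t p q; rewrite residue_opD IHN. Qed.

Lemma residue_runZ (R : comNzRingType) r (x : 'I_r -> R) y N t (a : R) p :
  residue_run x y N t (a *: p) = a *: residue_run x y N t p.
Proof. by elim: N t p => //= N IHN t p; rewrite residue_opZ IHN. Qed.

Lemma residue_run_mod (R : comNzRingType) r (x : 'I_r -> R) y N t u p :
  t = u %[mod r.+1] -> residue_run x y N t p = residue_run x y N u p.
Proof.
elim: N t u p => //= N IHN t u p tu; rewrite /residue_op tu; apply: IHN.
by rewrite -addn1 -[u.+1]addn1 -modnDml tu modnDml.
Qed.

Lemma residue_run_cat (R : comNzRingType) r (x : 'I_r -> R) y M N t p :
  residue_run x y (M + N) t p = residue_run x y N (t + M) (residue_run x y M t p).
Proof.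
by elim: M t p => [|M IHM] t p /=; rewrite ?addn0 // addnS -addSn IHM.
Qed.

(* Both kinds of step raise the height by 1 modulo r + 1. At height
   (r + 1) k + j, encoded by 'X^k, the two possible steps are the two terms of
   1 + x_(j+1) d/d'X if j < r, and those of 'X + y if j = r. *)
Lemma path_sum_residue_run (R : comNzRingType) r (x : 'I_r -> R) y N h :
  (r.+1 %| h + N)%N ->
  path_sum r (Lah_alpha x y) N h =
  (residue_run x y N h 'X^(h %/ r.+1)).[0].
Proof.
elim: N h => [|N IHN] h dvd_h.
  (* Since [r.+1] divides [h], the exponent [h %/ r.+1] is 0 only for [h = 0]; otherwise heights
     from 1 to [r] would also give exponent 0. *)
  rewrite path_sum0 /= hornerXn expr0n addn0 in dvd_h *.
  by rewrite -[in LHS](divnK dvd_h) muln_eq0 orbF.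
rewrite addnS -addSn in dvd_h.
rewrite path_sumS IHN //=.
have dvd_hr : (r <= h)%N -> (r.+1 %| (h - r) + N)%N.
  by move=> le_rh; rewrite -(dvdn_addl _ (dvdnn r.+1)) addnAC addnS subnK.
have eq_mod : (r <= h)%N -> (h - r) = h.+1 %[mod r.+1].
  by move=> le_rh; rewrite -(modnDr (h - r)) addnS subnK.
rewrite /residue_op [Lah_alpha _ _ h]/Lah_alpha.
have lt_mod := ltn_pmod h (ltn0Sn r).
case: insubP => [j ltjr jE|]; last first.
  (* At residue [r] a rise increases the exponent of z by 1, and a fall, of weight [y], keeps it. *)
  rewrite -leqNgt => le_r; have modE : (h %% r.+1 = r)%N.
    by apply/eqP; rewrite eqn_leq le_r -ltnS lt_mod.
  have hE := divn_eq h r.+1; rewrite modE in hE.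
  have le_rh : (r <= h)%N by rewrite hE leq_addl.
  rewrite le_rh IHN ?dvd_hr // mulrDl -exprS mul_polyC residue_runD residue_runZ.
  rewrite hornerD hornerZ (residue_run_mod _ _ _ _ (eq_mod le_rh)).
  have -> : (h.+1 %/ r.+1 = (h %/ r.+1).+1)%N.
    by rewrite {1}hE -addnS -mulSnr mulnK.
  by have -> : ((h - r) %/ r.+1 = h %/ r.+1)%N by rewrite {1}hE addnK mulnK.
(* At residue [j < r] a rise keeps the exponent k of z, and a fall, of weight k [x j], lowers it by
   1. *)
have hE := divn_eq h r.+1; rewrite -jE in hE.
rewrite derivXn residue_runD residue_runZ hornerD hornerZ.
have -> : (h.+1 %/ r.+1 = h %/ r.+1)%N.
  by rewrite {1}hE -addnS divnMDl // (divn_small (ltn_ord j : (j.+1 < r.+1)%N)) addn0.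
congr (_ + _).
(* For exponent 0 the height is below [r]: no fall is possible, and the derivative of ['X^0]
   vanishes accordingly. *)
case kE: (h %/ r.+1)%N hE => [|k] hE.
  rewrite hE mul0n add0n leqNgt ltn_ord /=.
  by rewrite -scaler_nat scale0r -(scale0r 0) residue_runZ scale0r horner0 mulr0.
have le_rh : (r <= h)%N by rewrite hE mulSn addSn -addnS -addnA leq_addr.
rewrite le_rh IHN ?dvd_hr // (residue_run_mod _ _ _ _ (eq_mod le_rh)).
rewrite -scaler_nat residue_runZ hornerZ mulrCA mulrA.
have -> // : ((h - r) %/ r.+1 = k)%N.
rewrite hE mulSnr -addnA addSnnS addnCA addKn divnMDl //.
by rewrite (divn_small (ltn_ord j : (j.+1 < r.+1)%N)) addn0.
Qed.

Lemma residue_runSr (R : comNzRingType) r (x : 'I_r -> R) y N t p :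
  residue_run x y N.+1 t p = residue_op x y (t + N) (residue_run x y N t p).
Proof. by rewrite -addn1 residue_run_cat. Qed.

(** Residues 0 to [r - 1] compose to the product of the 1 + x_(j+1) D, and residue [r] then
    multiplies by z + y. *)
Lemma residue_run_cycle (R : comNzRingType) r (x : 'I_r -> R) y p :
  residue_run x y r.+1 0 p =
  ('X + y%:P) * diffop (\prod_(i < r) (1 + x i *: 'X)) p.
Proof.
(* Extending [x] by 0 to all naturals allows induction on the number of factors. *)
pose xn k := oapp x 0 (insub k).
have xnE (i : 'I_r) : xn i = x i by rewrite /xn valK.
under eq_bigr do rewrite -xnE.
rewrite -(big_mkord xpredT (fun i => 1 + xn i *: 'X)).
have run_le k : (k <= r)%N -> residue_run x y k 0 p =
    diffop (\prod_(0 <= i < k) (1 + xn i *: 'X)) p.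
  elim: k => [|k IHk] lt_kr; first by rewrite big_nil diffop1.
  rewrite residue_runSr IHk; last exact: ltnW.
  have -> : \prod_(0 <= i < k.+1) (1 + xn i *: 'X) =
      (1 + xn k *: 'X) * \prod_(0 <= i < k) (1 + xn i *: 'X).
    by rewrite big_nat_recr // mulrC.
  rewrite diffop_mul1DX /residue_op add0n modn_small; last exact: ltnW.
  by rewrite insubT -(xnE (Ordinal lt_kr)).
rewrite residue_runSr run_le // add0n /residue_op modn_small //.
by rewrite insubF // ltnn.
Qed.

(** A path of length [r.+1 * n] consists of [n] full cycles of residues, and height 0 is encoded by
    ['X^0]. *)
Lemma Stieltjes_Rogers_iter (R : comNzRingType) r (x : 'I_r -> R) y n :
  Stieltjes_Rogers r (Lah_alpha x y) n =
  (iter n (fun p => ('X + y%:P) * diffop (\prod_(i < r) (1 + x i *: 'X)) p) 1).[0].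
Proof.
rewrite -[LHS]/(path_sum _ _ _ _) path_sum_residue_run; last first.
  exact: dvdn_mulr.
rewrite div0n expr0; congr _.[0]; elim: n => [|n IHn]; first by rewrite muln0.
rewrite mulnSr residue_run_cat IHn add0n iterS -residue_run_cycle.
by apply: residue_run_mod; rewrite modnMr mod0n.
Qed.

(** Expand over the set [J] of factors contributing ['X_i *: 'X]; degree [k] selects the sets of
    cardinality [k]. *)
Lemma coef_prod_1DX_mesym r k :
  (\prod_(i < r) (1 + ('X_i : {mpoly int[r]}) *: 'X : {poly {mpoly int[r]}}))`_k
  = mesym r int k.
Proof.
under eq_bigr do rewrite addrC.
rewrite bigA_distr /= coef_sum /mesym [RHS]big_mkcond /=.
apply: eq_big => [J|J _]; first by [].
rewrite -big_mkcond /= scaler_prod prodr_const coefZ coefXn eq_sym.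
by case: eqP; rewrite ?mulr1 ?mulr0.
Qed.

(** * Adding a smallest vertex to a forest *)

Definition graft_root n (cl : children_map n * {bseq n of 'I_n}) :
    children_map n.+1 :=
  [ffun v => insub_bseq n.+1
     (map (lift ord0) (if unlift ord0 v is Some u then cl.1 u : seq 'I_n
                       else cl.2 : seq 'I_n))].

Definition ungraft_root n (c : children_map n.+1) :
    children_map n * {bseq n of 'I_n} :=
  ([ffun u => insub_bseq n (pmap (unlift ord0) (c (lift ord0 u)))],
   insub_bseq n (pmap (unlift ord0) (c ord0))).

Lemma insub_bseqK T n (s : seq T) : (size s <= n)%N -> insub_bseq n s = s :> seq T.
Proof. by move=> le_sn; rewrite /insub_bseq insubdK. Qed.

Lemma uniq_size_ord n (s : seq 'I_n) : uniq s -> (size s <= n)%N.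
Proof. by move/card_uniqP <-; rewrite -[leqRHS]card_ord max_card. Qed.

Lemma graft_root0 n (cl : children_map n * {bseq n of 'I_n}) :
  graft_root cl ord0 = map (lift ord0) cl.2 :> seq 'I_n.+1.
Proof.
by rewrite ffunE unlift_none insub_bseqK // size_map leqW // size_bseq.
Qed.

Lemma graft_root_lift n (cl : children_map n * {bseq n of 'I_n}) u :
  graft_root cl (lift ord0 u) = map (lift ord0) (cl.1 u) :> seq 'I_n.+1.
Proof. by rewrite ffunE liftK insub_bseqK // size_map leqW // size_bseq. Qed.

Lemma graft_rootK n : cancel (@graft_root n) (@ungraft_root n).
Proof.
move=> [c l]; rewrite /ungraft_root graft_root0; congr (_, _).
  apply/ffunP=> u; rewrite ffunE; apply/val_inj => /=.
  by rewrite graft_root_lift (map_pK (@liftK _ _)) insub_bseqK // size_bseq.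
by apply/val_inj; rewrite /= (map_pK (@liftK _ _)) insub_bseqK // size_bseq.
Qed.

Lemma all_children_graft n (cl : children_map n * {bseq n of 'I_n}) :
  all_children (graft_root cl) =
  map (lift ord0) ((cl.2 : seq 'I_n) ++ all_children cl.1).
Proof.
rewrite /all_children enum_ordSl /= graft_root0 map_cat map_flatten -!map_comp.
by congr (_ ++ flatten _); apply: eq_map => u /=; rewrite graft_root_lift.
Qed.

Lemma uniq_children n (c : children_map n) v :
  uniq (all_children c) -> uniq (c v).
Proof.
have v_enum : v \in enum 'I_n by rewrite mem_enum.
rewrite /all_children; case/splitPr: (enum 'I_n) / v_enum => vs1 vs2.
by rewrite map_cat flatten_cat /= !cat_uniq => /and3P[_ _ /and3P[]].
Qed.

(** No child equals [ord0], so [pmap] drops nothing; the lists are duplicate-free, so they fit the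
    bound [n] and [insub_bseq] keeps them. *)
Lemma ungraft_rootK n (c : children_map n.+1) :
  increasing_ordered_forest c -> graft_root (ungraft_root c) = c.
Proof.
move=> /andP[uc /forallP lt_c].
have liftE v : map (lift ord0) (pmap (unlift ord0) (c v)) = c v :> seq 'I_n.+1.
  rewrite pmap_filter; last by move=> u; case: unliftP => [j ->|->].
  apply/all_filterP/allP => w wv; case: unliftP => // w0.
  by have /forallP/(_ w)/implyP/(_ wv) := lt_c v; rewrite w0.
have insubE v : insub_bseq n (pmap (unlift ord0) (c v)) =
    pmap (unlift ord0) (c v) :> seq 'I_n.
  apply: insub_bseqK; apply: uniq_size_ord.
  by rewrite -(map_inj_uniq (@lift_inj _ ord0)) liftE uniq_children.
apply/ffunP=> v; apply/val_inj => /=.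
case: (unliftP ord0 v) => [u ->|->].
  by rewrite graft_root_lift ffunE insubE liftE.
by rewrite graft_root0 insubE liftE.
Qed.

(** Absence of repeated children forces [cl.2] to be duplicate-free and disjoint from the old
    children. Lifted labels automatically exceed [ord0]. *)
Lemma graft_root_forest n (cl : children_map n * {bseq n of 'I_n}) :
  increasing_ordered_forest (graft_root cl) =
  increasing_ordered_forest cl.1 && (all (mem (Defs.roots cl.1)) cl.2 && uniq cl.2).
Proof.
rewrite /increasing_ordered_forest all_children_graft.
rewrite (map_inj_uniq (@lift_inj _ ord0)) cat_uniq.
have -> : [forall v, forall w, (w \in (graft_root cl v : seq _)) ==> (v < w)%N]
  = [forall v : 'I_n, forall w : 'I_n, (w \in (cl.1 v : seq 'I_n)) ==> (v < w)%N].
  apply/forallP/forallP => lt_c v; apply/forallP => w; apply/implyP => wv.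
    have /forallP/(_ (lift ord0 w))/implyP := lt_c (lift ord0 v).
    by rewrite graft_root_lift map_f //= => /(_ isT).
  case: (unliftP ord0 v) wv => [u ->|->].
    rewrite graft_root_lift => /mapP[w' w'u ->].
    by have /forallP/(_ w')/implyP/(_ w'u) := lt_c u.
  by rewrite graft_root0 => /mapP[w' _ ->].
have -> : has (mem cl.2) (all_children cl.1) = ~~ all (mem (Defs.roots cl.1)) cl.2.
  rewrite has_sym -has_predC; apply: eq_has => v /=.
  by rewrite inE negbK.
rewrite negbK; set F := [forall v, _].
by case: F; case: (all _ _); case: (uniq cl.2); case: (uniq (all_children _)).
Qed.

Lemma card_roots n (c : children_map n) :
  uniq (all_children c) -> #|Defs.roots c| = (n - size (all_children c))%N.
Proof.
move=> uc; rewrite -(card_uniqP uc) -[X in (X - _)%N]card_ord.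
by rewrite -(cardC (mem (all_children c))) addKn; apply: eq_card => v; rewrite !inE.
Qed.

Lemma card_roots_graft n (cl : children_map n * {bseq n of 'I_n}) :
  increasing_ordered_forest (graft_root cl) ->
  #|Defs.roots (graft_root cl)| = (#|Defs.roots cl.1| - size cl.2).+1.
Proof.
move=> /andP[ug _]; rewrite card_roots //.
move: ug; rewrite all_children_graft (map_inj_uniq (@lift_inj _ ord0)) => ug.
have /card_roots-> : uniq (all_children cl.1).
  by move: ug; rewrite cat_uniq => /and3P[].
(* The subtraction is exact: the old children and [cl.2] together form a duplicate-free list in
   ['I_n]. *)
rewrite size_map size_cat subSn.
  by rewrite -subnDA addnC.
by rewrite -size_cat uniq_size_ord.
Qed.

(** * Recurrence for the Lah polynomials *)

Definition forest_weight (R : comNzRingType) (phi : nat -> R) n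
    (c : children_map n) : R := \prod_(v < n) phi (nb_children c v).

Lemma forest_weight_graft (R : comNzRingType) (phi : nat -> R) n
    (cl : children_map n * {bseq n of 'I_n}) :
  forest_weight phi (graft_root cl) = phi (size cl.2) * forest_weight phi cl.1.
Proof.
rewrite /forest_weight big_ord_recl /nb_children graft_root0 size_map.
by congr (_ * _); apply: eq_bigr => u _; rewrite graft_root_lift size_map.
Qed.

Lemma Lah_polyE (R : comNzRingType) (phi : nat -> R) n :
  Lah_poly phi n = \sum_(c : children_map n | increasing_ordered_forest c)
    forest_weight phi c *: 'X^#|Defs.roots c|.
Proof.
rewrite /Lah_poly /Lah.
(* There are at most [n] roots, so [inord] does not alter their number. *)
rewrite (partition_big (fun c => inord #|Defs.roots c| : 'I_n.+1) xpredT) //=.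
apply: eq_bigr => k _; rewrite scaler_suml.
have kE (c : children_map n) : (inord #|Defs.roots c| == k) = (#|Defs.roots c| == k).
  rewrite -val_eqE /= inordK // ltnS -[X in (_ <= X)%N](card_ord n).
  exact: max_card.
apply: eq_big => [c|c /andP[_ /eqP->] //]; by rewrite kE.
Qed.

(** Bounded sequences are grouped by length; falling factorials count the duplicate-free tuples. *)
Lemma sum_uniq_bseq (R : comNzRingType) (T : finType) (A : pred T) n
    (F : nat -> {poly R}) :
  \sum_(l : {bseq n of T} | all A l && uniq l) F (size l) =
  \sum_(i < n.+1) F i *+ #|A| ^_ i.
Proof.
under [RHS]eq_bigr => i _.
  rewrite -card_uniq_tuples -sumr_const big_set /=.
  over.
rewrite sig_big_dep /= (reindex (@tagged_tuple_bseq n T)) /=; last first.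
  exact/onW_bij/tagged_tuple_bseq_bij.
by apply: eq_bigr => -[i t] _ /=; rewrite size_tuple.
Qed.

(* The vertex 0 is a root; its list of children is an arbitrary duplicate-free
   list of roots of the forest induced on the other vertices. There are k ^_ i
   such lists of length i for k roots, and k ^_ i is also the coefficient in
   the i-th derivative of 'X^k. *)
Lemma Lah_poly_recr (R : comNzRingType) (phi : nat -> R) n :
  Lah_poly phi n.+1 =
  'X * \sum_(i < n.+1) phi i *: (Lah_poly phi n)^`(i).
Proof.
rewrite Lah_polyE (reindex_onto (@graft_root n) (@ungraft_root n)); last first.
  by move=> c; apply: ungraft_rootK.
rewrite (eq_bigl (fun cl : children_map n * {bseq n of 'I_n} =>
    increasing_ordered_forest cl.1 &&
    (all (mem (Defs.roots cl.1)) cl.2 && uniq cl.2))); last first.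
  by move=> cl; rewrite graft_rootK eqxx andbT graft_root_forest.
rewrite (eq_bigr (fun cl : children_map n * {bseq n of 'I_n} =>
    forest_weight phi cl.1 *:
    (phi (size cl.2) *: 'X^((#|Defs.roots cl.1| - size cl.2).+1)))); last first.
  move=> cl gcl; rewrite forest_weight_graft scalerA mulrC card_roots_graft //.
  by rewrite graft_root_forest.
rewrite -(pair_big_dep (@increasing_ordered_forest n)
  (fun c (l : {bseq n of 'I_n}) => all (mem (Defs.roots c)) l && uniq l)
  (fun c (l : {bseq n of 'I_n}) => forest_weight phi c *:
    (phi (size l) *: 'X^((#|Defs.roots c| - size l).+1)))) /=.
under eq_bigr => c _.
  rewrite -scaler_sumr (sum_uniq_bseq (mem (Defs.roots c)) n
    (fun i => phi i *: 'X^((#|Defs.roots c| - i).+1))).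
  over.
rewrite Lah_polyE mulr_sumr.
under [RHS]eq_bigr do rewrite raddf_sum scaler_sumr mulr_sumr.
rewrite exchange_big; apply: eq_bigr => c _; rewrite scaler_sumr.
(* If [i] exceeds the number of roots, the exponent is truncated, but the falling factorial is 0 on
   both sides. *)
apply: eq_bigr => i _ /=; rewrite derivnZ derivnXn.
by rewrite exprS -!scalerAr !scalerMnr scalerA mulrC -scalerA mulrnAr.
Qed.

Lemma Lah_poly0 (R : comNzRingType) (phi : nat -> R) : Lah_poly phi 0 = 1.
Proof.
rewrite Lah_polyE (big_pred1 ([ffun=> [bseq]] : children_map 0)) => [|c].
  rewrite /forest_weight big_ord0 scale1r [#|_|]eq_card0 // => -[] //.
have -> : c = [ffun=> [bseq]] by apply/ffunP=> -[].
rewrite /= eqxx /increasing_ordered_forest /all_children enum_ord0 /=.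
by apply/forallP => -[].
Qed.

Lemma size_Lah_poly (R : comNzRingType) (phi : nat -> R) n :
  (size (Lah_poly phi n) <= n.+1)%N.
Proof. by rewrite /Lah_poly -poly_def size_poly. Qed.

(** * Comparison of the two iterations *)

Theorem theorem1p5 (r : nat) (hr : (1 <= r)%N) (n : nat) :
  Lah_poly (fun i : nat => mesym r int i) n =
  Stieltjes_Rogers r
    (Lah_alpha (fun j : 'I_r => ('X_j : {mpoly int[r]})%:P)
               ('X : {poly {mpoly int[r]}}))
    n.
Proof.
pose q : {poly {mpoly int[r]}} := \prod_(i < r) (1 + 'X_i *: 'X).
have LahS k : Lah_poly (fun i => mesym r int i) k.+1 =
    'X * diffop q (Lah_poly (fun i => mesym r int i) k).
  (* The recurrence stops at order [k], whatever the degree of [q]; this loses nothing, as the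
     polynomial has degree at most [k]. *)
  rewrite Lah_poly_recr (diffop_trunc q (size_Lah_poly _ k)).
  by congr (_ * _); apply: eq_bigr => i _; rewrite coef_prod_1DX_mesym.
rewrite Stieltjes_Rogers_iter.
have -> : \prod_(i < r) (1 + ('X_i : {mpoly int[r]})%:P *: 'X) = map_poly polyC q.
  rewrite rmorph_prod; apply: eq_bigr => i _.
  by rewrite rmorphD rmorph1 /= map_polyZ map_polyX.
set T := (X in iter n X).
(* The outer ['X] is z and ['X%:P] is y; [map_poly polyC] makes z the variable of the Lah
   polynomial, so the right side is L_n(z + y). *)
have -> : iter n T 1 =
    map_poly polyC (Lah_poly (fun i => mesym r int i) n) \Po ('X + 'X%:P).
  elim: n => [|n IHn]; first by rewrite Lah_poly0 rmorph1 comp_polyC.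
  rewrite iterS IHn /T diffop_comp_XaddC diffop_map LahS.
  by rewrite rmorphM /= map_polyX comp_polyM comp_polyX.
(* At z = 0 this substitutes y for the variable, which is composition with ['X]. *)
by rewrite horner_comp hornerD hornerX hornerC add0r -/(comp_poly _ _) comp_polyXr.
Qed.
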